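(* Let $0<\alpha<1$, let $\mathbf{x}=(x_1,\dots,x_N)\in\mathbb{R}^N$ be nonzero, let $s_{ij}$ ($1\le i\le N$, $1\le j\le M$) be i.i.d. $S(\alpha,1)$ random variables, and let $y_j=\sum_{i=1}^N x_is_{ij}$. Let $\epsilon>0$, $\theta=\left(\sum_{i=1}^N|x_i|^\alpha\right)^{1/\alpha}$ and $\psi=(\epsilon/\theta)^{\alpha/(1-\alpha)}$, and assume $\psi\le 1/3$. For each $i$ define the absolute minimum estimator $\hat x_{i,min}=y_t/s_{it}$, where $t=\arg\min_{1\le j\le M}|y_j/s_{ij}|$. Then for every coordinate $i$ with $x_i=0$, $$\Pr\left(|\hat x_{i,min}|>\epsilon\right)\le \frac{1}{(1+\psi)^M}.$$
   Context: A random variable $Z$ has the symmetric $\alpha$-stable distribution with unit scale, $S(\alpha,1)$, if its characteristic function is $E e^{\sqrt{-1}Zt}=e^{-|t|^\alpha}$. *)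

(* Defs.v *)
From HB Require Import structures.
From mathcomp Require Import all_boot all_order all_algebra.
From mathcomp Require Import all_classical all_reals all_analysis.
Set Implicit Arguments. Unset Strict Implicit. Unset Printing Implicit Defensive.
Import Order.TTheory GRing.Theory Num.Theory.
Local Open Scope classical_set_scope.
Local Open Scope ring_scope.

(* Mutual independence of a finite family of real random variables:
   the joint law of (X i)_i factorizes on measurable rectangles
   (taking B i = setT recovers every finite subfamily). *)
Definition mutually_independent d (T : measurableType d) (R : realType)
  (P : probability T R) (I : finType) (X : I -> T -> R) : Prop :=
  forall B : I -> set R, (forall i, measurable (B i)) ->
    P [set w | forall i, B i (X i w)] = (\prod_(i : I) P (X i @^-1` B i))%E.

(* Z ~ S(alpha,1): E exp(sqrt(-1) t Z) = exp(-|t|^alpha) for all real t,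
   written via real and imaginary parts of the characteristic function. *)
Definition sym_stable d (T : measurableType d) (R : realType)
  (P : probability T R) (alpha : R) (Z : T -> R) : Prop :=
  forall t : R,
    (\int[P]_w (cos (t * Z w))%:E = (expR (- (`|t| `^ alpha)))%:E)%E /\
    (\int[P]_w (sin (t * Z w))%:E = 0)%E.

(* t = argmin_j |y_j / s_j| (some minimizer; None only when M = 0). *)
Definition abs_min_index (R : realType) (M : nat) (y s : 'I_M -> R) : option 'I_M :=
  [pick j | [forall k, `|y j / s j| <= `|y k / s k|]].

Definition abs_min_est (R : realType) (M : nat) (y s : 'I_M -> R) : R :=
  match abs_min_index y s with
  | Some t => y t / s t
  | None => 0
  end.

(* Main.v *)
Require Import Defs.
From HB Require Import structures.
From mathcomp Require Import all_boot all_order all_algebra.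
From mathcomp Require Import all_classical all_reals all_analysis.
From mathcomp Require Import measurable_realfun.
From mathcomp Require Import ring lra.
Set Implicit Arguments. Unset Strict Implicit. Unset Printing Implicit Defensive.
Import Order.TTheory GRing.Theory Num.Theory.
Import numFieldNormedType.Exports.
Local Open Scope classical_set_scope.
Local Open Scope ring_scope.

(** For a coordinate with [x i = 0], put [X = y_j] and [Y = s i j].  Every
    combination [a X + b Y] is a scaled stable variable, with
    [E cos (r (a X + b Y)) = exp (- (Theta |a|^alpha + |b|^alpha) r^alpha)] and
    [Theta = theta ^ alpha].  Let [U = X - eps Y] and [V = X + eps Y], so that
    [|X| > eps |Y|] means [U V > 0].  Since
    [\int_R (ln |U + e^t V| - ln |U - e^t V|) dt = C sgn (U V)] for one constant
    [0 < C < oo], the expectation of [sgn (U V)] is an integral over [t] of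
    expected logarithms of stable variables, and those only depend on their
    scales: a Frullani integral [\int (cos (r w2) - cos (r w1)) dr / r] turns
    [ln |w1 / w2|] into characteristic functions.  With
    [h = eps ^ alpha / Theta <= 1] the pointwise inequality
    [ln ((q + h) / (1 + h q)) <= (1 - h) / (1 + h) ln q] then gives
    [E sgn (U V) <= (1 - h) / (1 + h)], the constant [C] cancelling.  Hence
    [P (|X| > eps |Y|) <= 1 / (1 + h) <= 1 / (1 + psi)], and the [M] columns are
    independent. *)

(** * Independence *)

Lemma probability_integrable_bounded d (T : measurableType d) (R : realType)
    (P : probability T R) (f : T -> R) (c : R) : measurable_fun setT f ->
  (forall x, `|f x| <= c) -> P.-integrable setT (EFin \o f).
Proof.
move=> mf fc; apply: measurable_bounded_integrable => //.
  by rewrite ltey_eq fin_num_measure.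
by exists c; split => [|x cx y _]; [exact: num_real|exact: le_trans (fc y) (ltW cx)].
Qed.

Section independence.
Context {d : measure_display} {T : measurableType d} {R : realType}.
Context (P : probability T R).

(** Both sides, as functions of [E], are finite measures: [P] restricted to [F] and [P] scaled by
    [P F]. They agree on the pi-system [G], hence on the sigma-algebra it generates. *)
Lemma sigma_algebra_independent_set (G : set (set T)) (F : set T) :
  G `<=` measurable -> G setT -> setI_closed G -> measurable F ->
  (forall E, G E -> P (E `&` F) = (P E * P F)%E) ->
  forall E, <<s G >> E -> P (E `&` F) = (P E * P F)%E.
Proof.
move=> Gm GT GI mF GF E sE.
have PFfin : P F \is a fin_num by rewrite fin_num_measure.
have PF0 : 0 <= fine (P F) by rewrite fine_ge0.
pose m1 : {measure set T -> \bar R} := mrestr P mF.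
pose m2 : {measure set T -> \bar R} := mscale (NngNum PF0) P.
rewrite (_ : P (E `&` F) = m1 E)// [RHS](_ : _ = m2 E); last first.
  by rewrite /m2 /= /mscale/= fineK// muleC.
apply: (@g_sigma_algebra_measure_unique _ _ _ G Gm (fun=> setT) _ _ m1 m2) => //.
- by rewrite bigcup_const.
- by move=> A GA; rewrite /m1 /m2 /= /mrestr /mscale/= fineK// muleC; exact: GF.
- by move=> _; rewrite /m1 /= /mrestr /= setTI ltey_eq PFfin.
Qed.

Section family.
Context {I : finType} (X : I -> T -> R).

(** A pi-system that generates the sigma-algebra of the variables with index in [A]. The sides [B i]
    are given for every [i], but those outside [A] impose nothing. *)
Definition cylinders (A : {pred I}) : set (set T) :=
  [set E | exists2 B : I -> set R, (forall i, measurable (B i)) &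
    E = [set w | forall i, i \in A -> B i (X i w)]].

Lemma cylindersT A : cylinders A setT.
Proof. by exists (fun=> setT) => //; apply/seteqP; split. Qed.

Lemma cylinders_setI A : setI_closed (cylinders A).
Proof.
move=> _ _ [B mB ->] [C mC ->]; exists (fun i => B i `&` C i).
  by move=> i; exact: measurableI.
by apply/seteqP; split => w /= => [[Bw Cw] i iA|BC];
  [split; [exact: Bw|exact: Cw]|split=> i /BC[]].
Qed.

Hypothesis mX : forall i, measurable_fun setT (X i).

Lemma cylinders_measurable A : cylinders A `<=` measurable.
Proof.
move=> _ [B mB ->].
rewrite [X in measurable X](_ : _ =
    \bigcap_(i in [set i | i \in A]) (X i @^-1` B i)); last first.
  by apply/seteqP; split.
apply: fin_bigcap_measurable; first exact: finite_finset.
by move=> i _; rewrite -[_ @^-1` _]setTI; exact: mX.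
Qed.

Lemma sigma_cylinders_measurable A : <<s cylinders A >> `<=` measurable.
Proof.
by apply: smallest_sub; [exact: sigma_algebra_measurable|exact: cylinders_measurable].
Qed.

Hypothesis indX : mutually_independent P X.

(** Replacing the sides outside [A] by [setT] gives a full rectangle, to which the factorization
    applies. *)
Let cylinderE (A : {pred I}) (B : I -> set R) : (forall i, measurable (B i)) ->
  P [set w | forall i, i \in A -> B i (X i w)] =
  (\prod_i if i \in A then P (X i @^-1` B i) else 1)%E.
Proof.
move=> mB; have := @indX (fun i => if i \in A then B i else setT).
rewrite (_ : [set w | _] = [set w | forall i, i \in A -> B i (X i w)]); last first.
  apply/seteqP; split => w /= H i; first by move=> iA; have := H i; rewrite iA.
  by case: ifPn => // iA; exact: H.
move=> ->; last by move=> i; case: ifP.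
apply: eq_bigr => i _; case: ifP => // _.
by rewrite preimage_setT probability_setT.
Qed.

(** The intersection is a cylinder over the union of the two blocks, and disjointness lets
    membership in [A] select the side. *)
Lemma cylinders_independent (A B : {pred I}) E F : {in A, forall i, i \notin B} ->
  cylinders A E -> cylinders B F -> P (E `&` F) = (P E * P F)%E.
Proof.
move=> AB [C mC ->] [D mD ->].
rewrite (_ : _ `&` _ = [set w | forall i, i \in [predU A & B] ->
    (if i \in A then C i else D i) (X i w)]); last first.
  apply/seteqP; split => w /=.
    move=> [HC HD] i; rewrite inE.
    by case: ifPn => [iA _|_ /= iB]; [exact: HC|exact: HD].
  move=> H; split => i iAB; have := H i; rewrite inE iAB/= ?orbT => /(_ isT) //.
  by case: ifPn => // /AB; rewrite iAB.
rewrite (cylinderE [predU A & B] (B := fun i => if i \in A then C i else D i));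
  last by move=> i; case: ifP.
rewrite !cylinderE//.
rewrite -big_split/=; apply: eq_bigr => i _; rewrite inE.
have [iA|iA] /= := boolP (i \in A); last by rewrite mul1e.
by rewrite (negbTE (AB _ iA)) mule1.
Qed.

(** The extension from a pi-system is made twice, once for each factor. *)
Lemma sigma_cylinders_independent (A B : {pred I}) E F : {in A, forall i, i \notin B} ->
  <<s cylinders A >> E -> <<s cylinders B >> F -> P (E `&` F) = (P E * P F)%E.
Proof.
move=> AB + sF; move: E.
apply: (@sigma_algebra_independent_set (cylinders A)) => //.
- exact: cylinders_measurable.
- exact: cylindersT.
- exact: cylinders_setI.
- exact: sigma_cylinders_measurable sF.
move=> E cE; rewrite setIC muleC; move: F sF.
apply: (@sigma_algebra_independent_set (cylinders B)) => //.
- exact: cylinders_measurable.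
- exact: cylindersT.
- exact: cylinders_setI.
- exact: cylinders_measurable cE.
by move=> F cF; rewrite setIC muleC; exact: cylinders_independent cE cF.
Qed.

Lemma sigma_cylindersS (A B : {pred I}) : {subset A <= B} ->
  <<s cylinders A >> `<=` <<s cylinders B >>.
Proof.
move=> AB; apply: sub_sigma_algebra2 => _ [C mC ->].
exists (fun i => if i \in A then C i else setT); first by move=> i; case: ifP.
apply/seteqP; split => w /= H i.
  by case: ifPn => // iA _; exact: H.
by move=> iA; have := H i (AB _ iA); rewrite iA.
Qed.

(** Viewing [X i] as a function on [T] with the smaller sigma-algebra lets membership of an event in
    it follow from ordinary measurability rules. *)
Lemma measurable_fun_cylinders (A : {pred I}) i : i \in A ->
  measurable_fun setT (X i : g_sigma_algebraType (cylinders A) -> R).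
Proof.
move=> iA _ B mB; rewrite setTI; apply: sub_sigma_algebra.
exists (fun k => if k == i then B else setT); first by move=> k; case: ifP.
apply/seteqP; split => w /= H; first by move=> k _; case: eqP => // ->.
by have := H i iA; rewrite eqxx.
Qed.

(* The events [E j] depend on disjoint blocks of variables, indexed by [p]. *)
Lemma probability_block_independent (J : finType) (p : I -> J)
    (E : J -> set T) :
  (forall j, <<s cylinders [pred i | p i == j] >> (E j)) ->
  P [set w | forall j, E j w] = (\prod_j P (E j))%E.
Proof.
move=> sE.
(* The induction also carries membership in the sigma-algebra of the blocks already treated, which
   independence from the next block requires. *)
suff H (r : seq J) : uniq r ->
    <<s cylinders [pred i | p i \in r] >> [set w | forall j, j \in r -> E j w] /\
    P [set w | forall j, j \in r -> E j w] = (\prod_(j <- r) P (E j))%E.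
  rewrite -big_enum/= -(H (enum J) (enum_uniq _)).2; congr (P _).
  by apply/seteqP; split => w /= Hw j; [move=> _|]; apply: Hw; rewrite mem_enum.
elim: r => [_|j r IH /= /andP[jr ur]].
  rewrite big_nil (_ : [set w | _] = setT); last by apply/seteqP; split.
  rewrite probability_setT; split => //.
  exact: (@measurableT _ (g_sigma_algebraType _)).
have [sr Pr] := IH ur.
have -> : [set w | forall k, k \in j :: r -> E k w] =
    E j `&` [set w | forall k, k \in r -> E k w].
  apply/seteqP; split => w /=.
    move=> Hw; split; first by apply: Hw; rewrite inE eqxx.
    by move=> k kr; apply: Hw; rewrite inE kr orbT.
  by move=> [Ej Hw] k; rewrite inE => /predU1P[->//|]; exact: Hw.
split.
  apply: (@measurableI _ (g_sigma_algebraType (cylinders [pred i | p i \in j :: r]))).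
    apply: sigma_cylindersS (sE j) => i.
    by rewrite !inE => /eqP ->; rewrite eqxx.
  apply: sigma_cylindersS sr => i.
  by rewrite !inE => ->; rewrite orbT.
rewrite big_cons -Pr; apply: sigma_cylinders_independent (sE j) sr => i.
by rewrite !inE => /eqP ->.
Qed.

End family.

(** Factorization on rectangles identifies the joint law of [(Y, Z)] with the product of the
    marginal laws; Fubini then separates the integrals. *)
Lemma integral_mul_independent (Y Z : {RV P >-> R}) (f g : R -> R) :
  (forall A B, measurable A -> measurable B ->
    P (Y @^-1` A `&` Z @^-1` B) = (P (Y @^-1` A) * P (Z @^-1` B))%E) ->
  measurable_fun setT f -> measurable_fun setT g ->
  (forall x, `|f x| <= 1) -> (forall x, `|g x| <= 1) ->
  (\int[P]_w (f (Y w) * g (Z w))%:E =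
   \int[P]_w (f (Y w))%:E * \int[P]_w (g (Z w))%:E)%E.
Proof.
move=> YZ mf mg f1 g1.
have bint d' (S : measurableType d') (Q : probability S R) (k : S -> R) :
    measurable_fun setT k -> (forall x, `|k x| <= 1) ->
    Q.-integrable setT (EFin \o k).
  exact: probability_integrable_bounded.
have mYZ : measurable_fun setT (fun w => (Y w, Z w)).
  by apply/measurable_fun_pairP; split.
pose YZm : {RV P >-> (R * R)%type} :=
  HB.pack (fun w => (Y w, Z w)) (isMeasurableFun.Build _ _ _ _ _ mYZ).
pose F (z : R * R) := f z.1 * g z.2.
have mF : measurable_fun setT F.
  by apply: measurable_funM; exact: measurableT_comp.
have F1 z : `|F z| <= 1 by rewrite normrM -[leRHS]mulr1 ler_pM.
transitivity (\int[distribution P YZm]_z (F z)%:E)%E.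
  rewrite integral_distribution//; first exact/measurable_EFinP.
  have := bint _ _ P (F \o (fun w => (Y w, Z w))); apply; last by move=> x; exact: F1.
  exact: (measurableT_comp mF mYZ).
transitivity (\int[(distribution P Y \x distribution P Z)%E]_z (F z)%:E)%E.
  apply: eq_measure_integral => /= A mA _; apply/esym.
  apply: product_measure_unique => // B C mB mC.
have iF : (distribution P Y \x distribution P Z)%E.-integrable setT (EFin \o F).
  apply: measurable_bounded_integrable => //.
    rewrite -setXTT /= product_measure1E//.
    by rewrite lte_mul_pinfty ?ltry//= ?fin_num_measure// ltey_eq fin_num_measure.
  by exists 1; split => // x x1 y _; exact: le_trans (F1 y) (ltW x1).
rewrite -(integral12_prod_meas1 iF)/=.
transitivity (\int[distribution P Y]_x
    ((f x)%:E * \int[distribution P Z]_y (g y)%:E))%E.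
  apply: eq_integral => x _; rewrite -integralZl//; last exact: bint.
rewrite -(fineK (integrable_fin_num _ (bint _ _ (distribution P Z) g mg g1)))//.
rewrite integralZr//; last exact: bint.
rewrite fineK ?integrable_fin_num//; last exact: bint.
by congr (_ * _)%E; rewrite integral_distribution//;
  (try exact/measurable_EFinP); apply: bint => //; exact: measurableT_comp.
Qed.

End independence.

(** * Sums of stable variables *)

Lemma measurable_cos (R : realType) : measurable_fun setT (@cos R).
Proof. by apply: continuous_measurable_fun; exact: continuous_cos. Qed.

Lemma measurable_sin (R : realType) : measurable_fun setT (@sin R).
Proof. by apply: continuous_measurable_fun; exact: continuous_sin. Qed.

Section stable_sums.
Context {d : measure_display} {T : measurableType d} {R : realType}.
Context (P : probability T R) {I : finType} (X : I -> {RV P >-> R}) (alpha : R).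
Hypothesis stX : forall i, sym_stable P alpha (X i).
Hypothesis indX : mutually_independent P (fun i => X i : T -> R).

(** Induction by the addition formulas. The sine integral accompanies the cosine one because [cosD]
    produces a product of sines, whose expectation vanishes by independence. *)
Let integral_sum_stable (c : I -> R) (r : seq I) : uniq r ->
  (\int[P]_w (cos (\sum_(i <- r) c i * X i w))%:E =
     (expR (- \sum_(i <- r) `|c i| `^ alpha))%:E)%E /\
  (\int[P]_w (sin (\sum_(i <- r) c i * X i w))%:E = 0)%E.
Proof.
elim: r => [_|j r IH /= /andP[jr ur]].
  rewrite big_nil oppr0 expR0; split.
    under eq_integral do rewrite big_nil cos0.
    by rewrite integral_cst//= probability_setT mule1.
  under eq_integral do rewrite big_nil sin0.
  exact: integral0.
have [IHc IHs] := IH ur.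
have mX i : measurable_fun setT (X i : T -> R) by [].
have mZ : measurable_fun setT (fun w => \sum_(i <- r) c i * X i w).
  by apply: measurable_sum => i; exact: measurable_funM.
pose Z : {RV P >-> R} :=
  HB.pack (fun w => \sum_(i <- r) c i * X i w) (isMeasurableFun.Build _ _ _ _ _ mZ).
have ind A B : measurable A -> measurable B ->
    P (X j @^-1` A `&` Z @^-1` B) = (P (X j @^-1` A) * P (Z @^-1` B))%E.
  move=> mA mB.
  apply: (@sigma_cylinders_independent _ _ _ P _ (fun i => X i : T -> R) mX indX
    (pred1 j) (mem r)).
  - by move=> i; rewrite inE => /eqP ->.
  - have := @measurable_fun_cylinders _ T R _ (fun i => X i : T -> R) (pred1 j) j.
    by rewrite inE eqxx => /(_ isT) /(_ measurableT _ mA); rewrite setTI.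
  - have : measurable_fun setT ((fun w => \sum_(i <- r) c i * X i w) :
        g_sigma_algebraType (cylinders (fun i => X i : T -> R) (mem r)) -> R).
      (* The guard [i \in r] makes every summand measurable for the sigma-algebra of the variables
         in [r], including those with other indices. *)
      rewrite (_ : (fun w => _) =
          fun w => \sum_(i <- r) if i \in r then c i * X i w else 0); last first.
        by apply/funext => w; rewrite big_seq big_mkcond.
      apply: measurable_sum => i.
      have [ir|_] := boolP (i \in r); last exact: measurable_cst.
      by apply: measurable_funM => //; exact: measurable_fun_cylinders.
    by move=> /(_ measurableT _ mB); rewrite setTI.
have mtrig (f : R -> R) : measurable_fun setT f ->
    measurable_fun setT (fun x => f (c j * x)).
  by move=> mf; apply: measurableT_comp => //; exact: mulrl_measurable.
have cos1 (x : R) : `|cos x| <= 1 by rewrite ler_norml cos_geN1 cos_le1.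
have sin1 (x : R) : `|sin x| <= 1 by rewrite ler_norml sin_geN1 sin_le1.
have prod (f g : R -> R) : measurable_fun setT f -> measurable_fun setT g ->
    (forall x, `|f x| <= 1) -> (forall x, `|g x| <= 1) ->
    (\int[P]_w (f (c j * X j w) * g (\sum_(i <- r) c i * X i w))%:E =
    \int[P]_w (f (c j * X j w))%:E *
    \int[P]_w (g (\sum_(i <- r) c i * X i w))%:E)%E /\
    P.-integrable setT
      (EFin \o (fun w => f (c j * X j w) * g (\sum_(i <- r) c i * X i w))).
  move=> mf mg f1 g1; split.
    exact: (integral_mul_independent (f := fun x => f (c j * x)) ind (mtrig _ mf) mg).
  apply: (@probability_integrable_bounded _ _ _ _ _ 1); last first.
    by move=> x; rewrite normrM -[leRHS]mulr1 ler_pM.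
  apply: measurable_funM; last exact: (measurableT_comp mg mZ).
  by apply: (measurableT_comp (mtrig _ mf)).
have mc := @measurable_cos R; have ms := @measurable_sin R.
have [cc icc] := prod cos cos mc mc cos1 cos1.
have [cs ics] := prod cos sin mc ms cos1 sin1.
have [sc isc] := prod sin cos ms mc sin1 cos1.
have [ss iss] := prod sin sin ms ms sin1 sin1.
have [cj sj] := stX j (c j); split.
  under eq_integral do rewrite big_cons cosD EFinB.
  rewrite integralB_EFin// cc ss IHs mule0 sube0 cj IHc -EFinM.
  by rewrite big_cons opprD expRD.
under eq_integral do rewrite big_cons sinD EFinD.
by rewrite integralD_EFin// sc cs IHs mule0 sj mul0e adde0.
Qed.

Lemma integral_cos_sum_stable (c : I -> R) (r : seq I) : uniq r ->
  (\int[P]_w (cos (\sum_(i <- r) c i * X i w))%:E =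
     (expR (- \sum_(i <- r) `|c i| `^ alpha))%:E)%E.
Proof. by move=> /(integral_sum_stable c)[]. Qed.

End stable_sums.

(** * Translation invariance and logarithmic averages *)

Section translation.
Context {R : realType}.
Let mu := @lebesgue_measure R.
Implicit Types (a p q : R) (f : R -> R).

Let shift a : measurableTypeR R -> measurableTypeR R := fun x => (x : R) + a.

Let measurable_shift a : measurable_fun setT (shift a).
Proof. exact: (@measurable_funD _ R R setT id (cst a)). Qed.

(** The image measure gives half-open intervals their length, which characterizes Lebesgue
    measure. *)
Let lebesgue_measure_shift a (A : set R) : measurable A ->
  mu A = pushforward mu (shift a) A.
Proof.
pose m : {measure set (measurableTypeR R) -> \bar R} := pushforward mu (shift a).
move=> mA; apply: (@lebesgue_measure_unique R (m (measurable_shift a)) _ A mA).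
move=> _ [[p q] _ <-].
rewrite /m/= /pushforward/=.
rewrite (_ : _ @^-1` _ = `]p - a, q - a]%classic); last first.
  by apply/seteqP; split => x /=; rewrite !in_itv/= ltrBlDr lerBrDr.
rewrite /mu !lebesgue_measure_itv/= !lte_fin ltrD2r -!EFinB.
by rewrite opprB addrA subrK.
Qed.

Let integral_shiftE a (D : set R) (f : R -> \bar R) :
  (\int[mu]_(x in D) f x = \int[pushforward mu (shift a)]_(x in D) f x)%E.
Proof.
pose m : {measure set (measurableTypeR R) -> \bar R} := pushforward mu (shift a).
apply: (eq_measure_integral (m (measurable_shift a))) => A mA _.
exact: lebesgue_measure_shift.
Qed.

Lemma ge0_integral_shift a (f : R -> \bar R) : measurable_fun setT f ->
  (forall x, 0 <= f x)%E ->
  (\int[mu]_x f (x + a)%R = \int[mu]_x f x)%E.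
Proof.
move=> mf f0; rewrite [RHS](integral_shiftE a) ge0_integral_pushforward//.
Qed.

Lemma continuous_itv_integrable f p q : continuous f ->
  mu.-integrable `[p, q] (EFin \o f).
Proof.
move=> cf; apply: continuous_compact_integrable; first exact: segment_compact.
exact: continuous_subspaceT.
Qed.

Lemma Rintegral_itv_shift f a p q : continuous f ->
  \int[mu]_(x in `[p, q]) f (x + a) = \int[mu]_(x in `[p + a, q + a]) f x.
Proof.
move=> cf; congr fine.
rewrite [RHS](integral_shiftE a).
have pre : shift a @^-1` `[p + a, q + a] = `[p, q]%classic.
  by apply/seteqP; split => x /=; rewrite !in_itv/= !lerD2r.
rewrite integral_pushforward//= ?pre//.
  by apply/measurable_EFinP; exact: continuous_measurable_fun.
apply: (continuous_itv_integrable (f := fun x => f (x + a))) => x.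
apply: continuous_comp; last exact: cf.
by apply: cvgD; [exact: cvg_id|exact: cvg_cst].
Qed.

Lemma Rintegral_itv_cat f p q r : continuous f -> p <= q -> q <= r ->
  \int[mu]_(x in `[p, r]) f x =
  \int[mu]_(x in `[p, q]) f x + \int[mu]_(x in `[q, r]) f x.
Proof.
move=> cf pq qr; rewrite -(Rintegral_itv_obnd_cbnd (r := q)).
  by rewrite -(@Rintegral_itvB R f (BLeft p) (BRight r) q) ?bnd_simp//;
    [rewrite addrC subrK|exact: continuous_itv_integrable].
apply: integrableS (continuous_itv_integrable q r cf) => //.
exact: subset_itv_oc_cc.
Qed.

(** The interval from [- n + a] to [n + b] is cut in two ways, at [- n + b] and at [n + a]; in the
    difference only the two end pieces survive. *)
Lemma Rintegral_itv_shiftB f a b (n : R) : continuous f -> a <= b -> 0 <= n ->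
  \int[mu]_(x in `[- n, n]) f (x + a) - \int[mu]_(x in `[- n, n]) f (x + b) =
  \int[mu]_(x in `[- n + a, - n + b]) f x - \int[mu]_(x in `[n + a, n + b]) f x.
Proof.
move=> cf ab n0; rewrite !Rintegral_itv_shift//.
have nn : - n <= n by rewrite (le_trans _ n0)// oppr_le0.
have := @Rintegral_itv_cat f (- n + a) (- n + b) (n + b) cf.
rewrite (@Rintegral_itv_cat f (- n + a) (n + a) (n + b))// ?lerD2l ?lerD2r//.
by move=> /(_ ab nn); lra.
Qed.

Lemma Rintegral_itv_le f (c p q : R) : continuous f -> p <= q ->
  (forall x, p <= x <= q -> f x <= c) ->
  \int[mu]_(x in `[p, q]) f x <= c * (q - p).
Proof.
move=> cf pq fc.
apply: (@le_trans _ _ (\int[mu]_(x in `[p, q]) c)).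
  apply: le_Rintegral => //; first exact: continuous_itv_integrable.
    exact: (continuous_itv_integrable (f := cst c)) (@cst_continuous _ _ _).
rewrite Rintegral_cst//= lebesgue_measure_itv/= lte_fin.
by case: ltgtP pq => // ->; rewrite subrr.
Qed.

Lemma Rintegral_itv_norm_le f (c p q : R) : continuous f -> p <= q ->
  (forall x, p <= x <= q -> `|f x| <= c) ->
  `|\int[mu]_(x in `[p, q]) f x| <= c * (q - p).
Proof.
move=> cf pq fc; apply: le_trans (le_normr_Rintegral _ _) _ => //.
  exact: continuous_itv_integrable.
apply: Rintegral_itv_le => // x.
exact: continuous_comp (cf x) (@norm_continuous _ _ _).
Qed.

End translation.

(** * Truncated cosine integrals and the Frullani limit *)

Section cosine_average.
Context {R : realType}.
Let mu := @lebesgue_measure R.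
Implicit Types (a b p q w x : R) (n : nat).

Let cos_expR_continuous w : continuous (fun x : R => cos (expR x * w)).
Proof.
move=> x; apply: continuous_comp; last exact: continuous_cos.
by apply: cvgM; [exact: continuous_expR|exact: cvg_cst].
Qed.

(** The cosine in the logarithmic variable, distinct from the [psi] of the theorem. *)
Let psi x : R := cos (expR x).

Let psi_continuous : continuous psi.
Proof.
by move=> x; apply: continuous_comp; [exact: continuous_expR|exact: continuous_cos].
Qed.

Let onem_cos_le x : 0 <= x -> `|1 - cos x| <= x.
Proof.
move=> x0; have [|y yx] := @MVT_segment R cos (fun y => - sin y) 0 x x0.
  by apply: continuous_subspaceT; exact: continuous_cos.
rewrite cos0 subr0 => h; rewrite distrC h normrM normrN (ger0_norm x0).
by rewrite ler_piMl// sin_max.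
Qed.

(** Towards minus infinity [psi] is close to 1, with error at most [expR x], so the integral is
    close to the length of the interval. *)
Let psi_near_Ny p q : p <= q ->
  `|\int[mu]_(x in `[p, q]) psi x - (q - p)| <= expR q * (q - p).
Proof.
move=> pq; have -> : q - p = \int[mu]_(x in `[p, q]) 1.
  rewrite Rintegral_cst//= lebesgue_measure_itv/= lte_fin mul1r.
  by case: ltgtP pq => // ->; rewrite subrr.
rewrite -RintegralB//; first last.
- exact: (continuous_itv_integrable (f := cst 1)) (@cst_continuous _ _ _).
- exact: continuous_itv_integrable.
have -> : \int[mu]_(x in `[p, q]) 1 = q - p.
  rewrite Rintegral_cst//= lebesgue_measure_itv/= lte_fin mul1r.
  by case: ltgtP pq => // ->; rewrite subrr.
apply: Rintegral_itv_norm_le => // [x|x /andP[_ xq]].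
  by apply: cvgB; [exact: psi_continuous|exact: cvg_cst].
by rewrite distrC (le_trans (onem_cos_le (expR_ge0 _)))// ler_expR.
Qed.

(* Integration by parts against the primitive [sin (exp x) * exp (- x)]. *)
Let psi_near_y p q : p <= q ->
  `|\int[mu]_(x in `[p, q]) psi x| <= (2 + (q - p)) * expR (- p).
Proof.
rewrite le_eqVlt => /predU1P[<-|pq].
  rewrite set_itv1 Rintegral_set1 normr0 mulr_ge0// ?expR_ge0//.
  by rewrite subrr addr0.
pose F x : R := sin (expR x) * expR (- x).
pose f x : R := psi x - sin (expR x) * expR (- x).
have dF x : is_derive x 1 F (f x).
  have d1 : is_derive x 1 (fun x : R => sin (expR x)) (cos (expR x) * expR x).
    exact: is_derive1_comp.
  have d2 : is_derive x 1 (fun x : R => expR (- x)) (expR (- x) * - 1).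
    by apply: (@is_derive1_comp R expR -%R); exact: is_deriveNid.
  apply: (is_derive_eq (is_deriveM d1 d2)).
  rewrite /f /psi /GRing.scale/= expRN.
  by field; rewrite gt_eqF ?expR_gt0.
have cs : continuous F.
  by move=> x; apply: differentiable_continuous; apply/derivable1_diffP; have [] := dF x.
have cf : continuous f by move=> x; apply: cvgB; [exact: psi_continuous|exact: cs].
have H : \int[mu]_(x in `[p, q]) f x = F q - F p.
  rewrite /Rintegral (@continuous_FTC2 _ f F)//.
  - exact: continuous_subspaceT.
  - split.
    + by move=> x _; have [] := dF x.
    + exact: cvg_at_right_filter (cs p).
    + exact: cvg_at_left_filter (cs q).
  - by move=> x _; rewrite derive1E; have [] := dF x.
(* Since [f] is the derivative of [F], [psi] equals that derivative plus [F], and [F] itself is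
   exponentially small. *)
have -> : \int[mu]_(x in `[p, q]) psi x = F q - F p + \int[mu]_(x in `[p, q]) F x.
  rewrite -H -RintegralD//; [|exact: continuous_itv_integrable..].
  by apply: eq_Rintegral => x _; rewrite subrK.
have Fp x : p <= x -> `|F x| <= expR (- p).
  move=> px; rewrite normrM -[leRHS]mul1r ler_pM ?sin_max//.
  by rewrite ger0_norm ?expR_ge0// ler_expR lerN2.
have IF : `|\int[mu]_(x in `[p, q]) F x| <= expR (- p) * (q - p).
  apply: Rintegral_itv_norm_le => //; first exact: ltW.
  by move=> x /andP[px _]; exact: Fp.
apply: le_trans (ler_normD _ _) _.
apply: le_trans (lerD (ler_normB _ _) IF) _.
have := Fp q (ltW pq); have := Fp p (lexx p); lra.
Qed.

(* With [r = exp x] this is [\int cos (r w) dr / r] over [exp (- n), exp n]. *)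
Definition cos_average n w : R :=
  \int[mu]_(x in `[- n%:R, n%:R]) cos (expR x * w).

(** In the variable [x = ln r], scaling by [|w|] becomes translation by [ln |w|]; the sign of [w] is
    lost because cosine is even. *)
Let cos_averageE n w : w != 0 ->
  cos_average n w = \int[mu]_(x in `[- n%:R, n%:R]) psi (x + ln `|w|).
Proof.
move=> w0; apply: eq_Rintegral => x _; rewrite /psi expRD lnK ?posrE ?normr_gt0//.
by have [_|_] := ger0P w; rewrite // mulrN cosN.
Qed.

Let cos_averageB_lt n w1 w2 : w1 != 0 -> w2 != 0 -> `|w2| <= `|w1| ->
  let a := ln `|w2| in let b := ln `|w1| in
  a <= b /\ cos_average n w2 - cos_average n w1 =
  \int[mu]_(x in `[- n%:R + a, - n%:R + b]) psi x -
  \int[mu]_(x in `[n%:R + a, n%:R + b]) psi x.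
Proof.
move=> w10 w20 w21 a b.
have ab : a <= b by rewrite /a /b ler_ln ?posrE ?normr_gt0.
by split => //; rewrite !cos_averageE// (Rintegral_itv_shiftB psi_continuous ab).
Qed.

Lemma cos_averageN n w : cos_average n (- w) = cos_average n w.
Proof. by apply: eq_Rintegral => x _; rewrite mulrN cosN. Qed.

(** The two end pieces left by the translation have length [|ln |w1| - ln |w2||] and an integrand at
    most 1 in absolute value. Being uniform in [n], the bound serves for domination. *)
Lemma norm_cos_averageB_le n w1 w2 : w1 != 0 -> w2 != 0 ->
  `|cos_average n w2 - cos_average n w1| <= 2 * `|ln `|w1| - ln `|w2| |.
Proof.
wlog w21 : w1 w2 / `|w2| <= `|w1| => [H w10 w20|].
  have [/H|/ltW/H] := lerP `|w2| `|w1|; first exact.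
  by rewrite distrC [`|ln _ - _|]distrC; exact.
move=> w10 w20; have [ab ->] := cos_averageB_lt n w10 w20 w21.
rewrite [`|ln _ - ln _|]ger0_norm ?subr_ge0//.
have psi1 x : `|psi x| <= 1 by rewrite cos_max.
have I p : `|\int[mu]_(x in `[p + ln `|w2|, p + ln `|w1|]) psi x| <=
    ln `|w1| - ln `|w2|.
  apply: le_trans (Rintegral_itv_norm_le (c := 1) _ _ _) _ => //.
    by rewrite lerD2l.
  by lra.
apply: le_trans (ler_normB _ _) _.
by have := I (- n%:R); have := I n%:R; lra.
Qed.

(** Frullani: the left end piece tends to its length, the right one to 0. *)
Lemma cvg_cos_averageB w1 w2 : w1 != 0 -> w2 != 0 ->
  cos_average n w2 - cos_average n w1 @[n --> \oo] --> ln `|w1| - ln `|w2|.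
Proof.
wlog w21 : w1 w2 / `|w2| <= `|w1| => [H w10 w20|].
  have [/H|/ltW/H] := lerP `|w2| `|w1|; first exact.
  by move=> /(_ w20 w10) /cvgN; rewrite !opprB.
move=> w10 w20; set a := ln `|w2|; set b := ln `|w1|.
have ab : a <= b by have [] := cos_averageB_lt 0 w10 w20 w21.
(* The two summands are the errors of the left and right end pieces after the common factor
   [expR (- n%:R)], itself at most [harmonic n], is taken out. *)
pose K := expR b * (b - a) + (2 + (b - a)) * expR (- a).
have K0 : 0 <= K.
  by apply: addr_ge0; apply: mulr_ge0; rewrite ?expR_ge0//; lra.
have bnd n : `|b - a - (cos_average n w2 - cos_average n w1)| <= K * harmonic n.
  have [_ ->] := cos_averageB_lt n w10 w20 w21.
  have en : expR (- n%:R) <= harmonic n :> R.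
    rewrite /harmonic expRN lef_pV2 ?posrE ?expR_gt0//.
    by apply: le_trans (expR_ge1Dx _); rewrite -natr1 addrC.
  apply: le_trans (ler_wpM2l K0 en).
  have p1 : - n%:R + a <= - n%:R + b by rewrite lerD2l.
  have p2 : n%:R + a <= n%:R + b by rewrite lerD2l.
  have := psi_near_Ny p1; have := psi_near_y p2.
  rewrite opprD !expRD.
  set I1 := \int[mu]_(x in `[_, _]) _; set I2 := \int[mu]_(x in `[_, _]) _.
  rewrite -/a -/b => h2 h1.
  rewrite (_ : b - a - _ = (b - a - I2) + I1); last by lra.
  apply: le_trans (ler_normD _ _) _.
  rewrite distrC in h1.
  rewrite (_ : b - a - I2 = - n%:R + b - (- n%:R + a) - I2); last by lra.
  apply: le_trans (lerD h1 h2) _.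
  by rewrite /K le_eqVlt; apply/orP; left; apply/eqP; ring.
apply/cvgrPdist_le => e e0.
have [d d0 Kd] : exists2 d, 0 < d & K * d <= e.
  (* The denominator is [K + 1] because [K] is only known to be nonnegative. *)
  exists (e / (K + 1)); first by rewrite divr_gt0// ltr_wpDl.
  rewrite mulrA ler_pdivrMr ?ltr_wpDl// mulrC ler_pM2l//; lra.
have /cvgrPdist_le/(_ _ d0) := @cvg_harmonic R.
apply: filterS => n; rewrite sub0r normrN => nd; apply: le_trans (bnd n) _.
apply: le_trans Kd; apply: ler_wpM2l => //; exact: le_trans (ler_norm _) nd.
Qed.

Lemma cos_average_continuous n : continuous (cos_average n).
Proof.
move=> w; apply: (@continuity_under_integral R _ _ mu (fun w x => cos (expR x * w))
  `[- n%:R, n%:R] _ (w - 1) (w + 1) _ _ (cst 1)) => //.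
- by move=> v _; exact: continuous_itv_integrable.
- apply: aeW => x _ v _; apply: continuous_comp; last exact: continuous_cos.
  by apply: cvgM; [exact: cvg_cst|exact: cvg_id].
- exact: (continuous_itv_integrable (f := cst 1)) (@cst_continuous _ _ _).
- by move=> v _; apply: aeW => x _; exact: cos_max.
- by rewrite inE/= in_itv/= ltrBlDr ltrDl ltr01.
Qed.

Lemma norm_cos_average_le n w : `|cos_average n w| <= 2 * n%:R.
Proof.
apply: le_trans (Rintegral_itv_norm_le (c := 1) _ _ _) _ => //.
- by rewrite (@le_trans _ _ 0)// oppr_le0.
- by move=> x _; exact: cos_max.
- by lra.
Qed.

(** The factor [A] acts as a translation by [ln A / alpha]. The left end piece is at most its length
    because [phi <= 1], and the right one is nonnegative, so the bound holds for each [n] without a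
    limit. *)
Lemma exp_average_le n (alpha A1 A2 : R) : 0 < alpha -> 0 < A2 -> A2 <= A1 ->
  \int[mu]_(x in `[- n%:R, n%:R]) expR (- (A2 * expR (alpha * x))) -
  \int[mu]_(x in `[- n%:R, n%:R]) expR (- (A1 * expR (alpha * x))) <=
  (ln A1 - ln A2) / alpha.
Proof.
move=> al0 A20 A21; have A10 := lt_le_trans A20 A21.
pose phi x : R := expR (- expR (alpha * x)).
have cphi : continuous phi.
  move=> x; apply: continuous_comp; last exact: continuous_expR.
  apply: cvgN; apply: continuous_comp; last exact: continuous_expR.
  by apply: cvgM; [exact: cvg_cst|exact: cvg_id].
have E (A : R) : 0 < A ->
    \int[mu]_(x in `[- n%:R, n%:R]) expR (- (A * expR (alpha * x))) =
    \int[mu]_(x in `[- n%:R, n%:R]) phi (x + ln A / alpha).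
  move=> A0; apply: eq_Rintegral => x _.
  rewrite /phi mulrDr mulrCA divff ?gt_eqF// mulr1 expRD lnK//.
  by rewrite [in RHS]mulrC.
have ab : ln A2 / alpha <= ln A1 / alpha by rewrite ler_pM2r ?invr_gt0// ler_ln.
rewrite (E _ A20) (E _ A10) (Rintegral_itv_shiftB cphi ab)// mulrBl.
have I0 : 0 <= \int[mu]_(x in `[n%:R + ln A2 / alpha, n%:R + ln A1 / alpha]) phi x.
  by apply: Rintegral_ge0 => x _; exact: expR_ge0.
have I1 : \int[mu]_(x in `[- n%:R + ln A2 / alpha, - n%:R + ln A1 / alpha]) phi x
    <= 1 * (- n%:R + ln A1 / alpha - (- n%:R + ln A2 / alpha)).
  apply: Rintegral_itv_le => //; first by rewrite lerD2l.
  by move=> x _; rewrite /phi -expR0 ler_expR oppr_le0 expR_ge0.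
by move: I0 I1; lra.
Qed.

End cosine_average.

(** * The logarithmic kernel *)

Section log_kernel.
Context {R : realType}.
Let mu := @lebesgue_measure R.
Implicit Types (a t u v : R).

(** Away from 0 this is [ln (coth (|t| / 2))]. At the singular point [t = 0] the convention
    [ln 0 = 0] gives the value [ln 2]. *)
Definition log_kernel t : R := ln (1 + expR t) - ln `|1 - expR t|.

Lemma onem_expR_neq0 t : t != 0 -> 1 - expR t != 0.
Proof.
by apply: contra_neq => /eqP; rewrite subr_eq0 -expR0 => /eqP/expR_inj.
Qed.

Lemma measurable_log_kernel : measurable_fun setT log_kernel.
Proof.
have mln (f : R -> R) : measurable_fun setT f -> measurable_fun setT (fun t => ln (f t)).
  exact: measurableT_comp (@measurable_ln R).
have mexp : measurable_fun setT (@expR R) by exact: measurable_expR.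
apply: measurable_funB; apply: mln; first exact: measurable_funD.
by apply: measurableT_comp => //; exact: measurable_funB.
Qed.

Lemma log_kernelN t : log_kernel (- t) = log_kernel t.
Proof.
have [->|t0] := eqVneq t 0; first by rewrite oppr0.
have e0 := expR_gt0 t; have en0 := expR_gt0 (- t).
have h : expR t * expR (- t) = 1 by rewrite -expRD subrr expR0.
have n0 : 0 < `|1 - expR t| by rewrite normr_gt0 onem_expR_neq0.
rewrite /log_kernel.
rewrite (_ : 1 + expR (- t) = expR (- t) * (1 + expR t)); last first.
  by rewrite mulrDr mulr1 mulrC h addrC.
rewrite (_ : 1 - expR (- t) = expR (- t) * - (1 - expR t)); last first.
  by rewrite mulrN mulrBr mulr1 opprB mulrC h.
by rewrite normrM normrN gtr0_norm// !lnM ?posrE ?addr_gt0// expRK; lra.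
Qed.

Lemma log_kernel_ge0 t : 0 <= log_kernel t.
Proof.
rewrite subr_ge0; have e0 := expR_gt0 t.
have [->|n0] := eqVneq (1 - expR t) 0.
  by rewrite normr0 ln0// ln_ge0// lerDl ltW.
rewrite ler_ln ?posrE ?addr_gt0 ?normr_gt0// ler_norml; lra.
Qed.

Lemma log_kernel_gt0 t : t != 0 -> 0 < log_kernel t.
Proof.
move=> t0; rewrite subr_gt0; have e0 := expR_gt0 t.
have n0 := onem_expR_neq0 t0.
rewrite ltr_ln ?posrE ?addr_gt0 ?normr_gt0// ltr_norml; lra.
Qed.

Let continuous_log_kernel t : t != 0 -> {for t, continuous log_kernel}.
Proof.
move=> t0; have e0 := expR_gt0 t.
have n0 := onem_expR_neq0 t0.
apply: cvgB.
  apply: (@continuous_comp _ _ _ (fun t : R => 1 + expR t) (@ln R)).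
    by apply: cvgD; [exact: cvg_cst|exact: continuous_expR].
  by apply: continuous_ln; rewrite addr_gt0.
apply: (@continuous_comp _ _ _ (fun t : R => `|1 - expR t|) (@ln R)).
  apply: (@continuous_comp _ _ _ (fun t : R => 1 - expR t) (@Num.norm _ R)).
    by apply: cvgB; [exact: cvg_cst|exact: continuous_expR].
  exact: norm_continuous.
by apply: continuous_ln; rewrite normr_gt0.
Qed.

(* [ln y <= 2 (sqrt y - 1)] bounds the kernel by the derivative of [F]. *)
Let F t : R := 8 * Num.sqrt (1 - expR (- t)).
Let f t : R := 4 * expR (- t) / Num.sqrt (1 - expR (- t)).

Let onem_gt0 t : 0 < t -> 0 < 1 - expR (- t).
Proof. by move=> t0; rewrite subr_gt0 -[ltRHS]expR0 ltr_expR oppr_lt0. Qed.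

Let log_kernel_le t : 0 < t -> log_kernel t <= f t.
Proof.
move=> t0; rewrite -log_kernelN /log_kernel /f.
set x := expR (- t); have x0 : 0 < x := expR_gt0 _; have x1 := onem_gt0 t0.
rewrite -/x in x1; rewrite gtr0_norm//.
(* The kernel is [2 (ln b - ln a) <= 2 (b / a - 1)]. As [a + b >= 1], this is at most
   [2 (b - a) (b + a) / a = 4 x / a]. *)
set a := Num.sqrt (1 - x); set b := Num.sqrt (1 + x).
have a0 : 0 < a by rewrite sqrtr_gt0.
have b1 : 1 < b by rewrite -sqrtr1 ltr_sqrt; lra.
have b0 : 0 < b by lra.
have a2 : a ^+ 2 = 1 - x by rewrite sqr_sqrtr// ltW.
have b2 : b ^+ 2 = 1 + x by rewrite sqr_sqrtr//; lra.
rewrite -a2 -b2 !lnXn//.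
have ba0 : 0 < b / a by rewrite divr_gt0.
have h : ln b - ln a <= b / a - 1.
  rewrite -lnV// -lnM ?posrE ?invr_gt0//.
  have -> : ln (b / a) = ln (1 + (b / a - 1)) by congr (ln _); lra.
  by apply: le_ln1Dx; lra.
have -> : 4 * x / a = 2 * ((b - a) * (b + a)) / a.
  by rewrite -subr_sqr a2 b2; congr (_ / _); lra.
have h2 : b / a - 1 <= (b - a) * (b + a) / a.
  rewrite -[X in _ - X](divff (lt0r_neq0 a0)) -mulrBl ler_pM2r ?invr_gt0//.
  rewrite ler_peMr; nra.
rewrite !mulr2n -mulrA; lra.
Qed.

Let dF t : 0 < t -> is_derive t 1 F (f t).
Proof.
move=> t0; have x1 := onem_gt0 t0.
have d1 : is_derive t 1 (fun t : R => 1 - expR (- t)) (expR (- t)).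
  have d2 : is_derive t 1 (fun x : R => expR (- x)) (expR (- t) * - 1).
    by apply: (@is_derive1_comp R expR -%R); exact: is_deriveNid.
  have d0 : is_derive t 1 (cst (1 : R)) 0 by exact: is_derive_cst.
  by apply: (is_derive_eq (is_deriveB d0 d2)); rewrite mulrN1 sub0r opprK.
have d3 := @is_derive1_comp R (@Num.sqrt R) (fun t : R => 1 - expR (- t)) t _ _
  (is_derive1_sqrt x1) d1.
apply: (is_derive_eq (is_deriveZ 8 d3)).
rewrite /f /GRing.scale/=; field.
by rewrite gt_eqF// sqrtr_gt0.
Qed.

Let continuousF : continuous F.
Proof.
move=> t; apply: cvgM; first exact: cvg_cst.
apply: (@continuous_comp _ _ _ (fun t : R => 1 - expR (- t)) (@Num.sqrt R));
  last exact: sqrt_continuous.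
apply: cvgB; first exact: cvg_cst.
by apply: (@continuous_comp _ _ _ (@GRing.opp R) expR);
  [exact: opp_continuous|exact: continuous_expR].
Qed.

Let continuousf a : 0 < a -> {within `[a, +oo[, continuous f}.
Proof.
move=> a0; apply: continuous_in_subspaceT => t; rewrite inE/= in_itv/= andbT => ta.
have t0 := lt_le_trans a0 ta; have x1 := onem_gt0 t0.
have ce : expR (- x) @[x --> t] --> expR (- t).
  by apply: (@continuous_comp _ _ _ (@GRing.opp R) expR);
    [exact: opp_continuous|exact: continuous_expR].
apply: cvgM; first by apply: cvgM; [exact: cvg_cst|].
apply: cvgV; first by rewrite gt_eqF// sqrtr_gt0.
apply: (@continuous_comp _ _ _ (fun t : R => 1 - expR (- t)) (@Num.sqrt R));
  last exact: sqrt_continuous.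
by apply: cvgB; [exact: cvg_cst|].
Qed.

(** [F] is nonnegative and tends to 8 at infinity. The bound is free of [a], which may therefore go
    to 0. *)
Let integral_f_le a : 0 < a -> (\int[mu]_(t in `[a, +oo[) (f t)%:E <= 8%:E)%E.
Proof.
move=> a0; rewrite (@ge0_continuous_FTC2y _ f F a 8).
- by rewrite -EFinB lee_fin gerBl mulr_ge0// sqrtr_ge0.
- by move=> t _; rewrite divr_ge0 ?sqrtr_ge0// mulr_ge0// expR_ge0.
- exact: continuousf.
- rewrite -[X in _ --> X]mulr1; apply: cvgM; first exact: cvg_cst.
  rewrite -[X in _ --> X](@sqrtr1 R) -[in X in _ --> X](subr0 (1 : R)).
  apply: (@cvg_comp _ _ _ (fun t : R => 1 - expR (- t)) (@Num.sqrt R));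
    last exact: sqrt_continuous.
  by apply: cvgB; [exact: cvg_cst|exact: cvgr_expR].
- by move=> t at_; have [] := dF (lt_trans a0 at_).
- by apply: cvg_at_right_filter; exact: continuousF.
- move=> t; rewrite in_itv/= andbT => at_; rewrite derive1E.
  by have [] := dF (lt_trans a0 at_).
Qed.

Let integral_log_kernel_y a : 0 < a ->
  (\int[mu]_(t in `[a, +oo[) (log_kernel t)%:E <= 8%:E)%E.
Proof.
move=> a0; apply: le_trans (integral_f_le a0); apply: ge0_le_integral => //.
- by move=> t _; rewrite lee_fin log_kernel_ge0.
- by apply/measurable_EFinP/measurable_funTS; exact: measurable_log_kernel.
- apply/measurable_EFinP; apply: subspace_continuous_measurable_fun => //.
  exact: continuousf.
- move=> t /=; rewrite in_itv/= andbT => ta.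
  by rewrite lee_fin log_kernel_le// (lt_le_trans a0).
Qed.

Let integral_log_kernel_Ny a : 0 < a ->
  (\int[mu]_(t in `]-oo, (- a)%R]) (log_kernel t)%:E <= 8%:E)%E.
Proof.
move=> a0; rewrite ge0_integration_by_substitutionNy.
- under eq_integral do rewrite /= log_kernelN.
  exact: integral_log_kernel_y.
- apply: continuous_in_subspaceT => t; rewrite inE/= in_itv/= => ta.
  by apply: continuous_log_kernel; rewrite lt_eqF// (le_lt_trans ta)// oppr_lt0.
- by move=> t _; exact: log_kernel_ge0.
Qed.

(** The sets [A n], where [|t| >= 1 / (n + 1)], increase to the punctured line. Each half of [A n]
    contributes at most 8; monotone convergence passes to the union and the point 0 is null. *)
Lemma integral_log_kernel_lty : (\int[mu]_t (log_kernel t)%:E < +oo)%E.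
Proof.
pose A (n : nat) : set R :=
  `]-oo, (- n.+1%:R^-1)%R]%classic `|` `[n.+1%:R^-1, +oo[%classic.
have n0 (n : nat) : 0 < n.+1%:R^-1 :> R by rewrite invr_gt0.
have mA n : measurable (A n) by exact: measurableU.
have mk (D : set R) : measurable_fun D (fun t : R => (log_kernel t)%:E).
  by apply/measurable_EFinP/measurable_funTS; exact: measurable_log_kernel.
have k0 (t : R) : (0 <= (log_kernel t)%:E)%E by rewrite lee_fin log_kernel_ge0.
have IA n : (\int[mu]_(t in A n) (log_kernel t)%:E <= 16%:E)%E.
  rewrite ge0_integral_setU//=.
    rewrite (_ : 16%:E = 8%:E + 8%:E)%E; last by rewrite -EFinD; congr _%:E; lra.
    by apply: leeD; [exact: integral_log_kernel_Ny|exact: integral_log_kernel_y].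
    exact: mk.
  apply/disj_setPS => t /= []; rewrite !in_itv/= andbT => h1 h2.
  by move: h1 h2 (n0 n); move: (n.+1%:R^-1) => c; lra.
have UA : \bigcup_n A n = [set~ 0].
  apply/seteqP; split => [t [n _] /= [] /=|t /= /eqP t0].
  - by rewrite in_itv/= => h t0; move: h (n0 n); move: (n.+1%:R^-1) => c; lra.
  - by rewrite in_itv/= andbT => h t0; move: h (n0 n); move: (n.+1%:R^-1) => c; lra.
  have /ltr_add_invr [n hn] : 0 < `|t| by rewrite normr_gt0.
  rewrite add0r in hn; exists n => //; rewrite /A /= !in_itv/= andbT.
  have [tge|tlt] := ger0P t; [right|left]; first by rewrite ger0_norm// in hn; exact: ltW.
  by rewrite ltr0_norm// in hn; rewrite lerNr ltW.
have ndA : nondecreasing_seq A.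
  apply/nondecreasing_seqP => n; rewrite subsetEset => t.
  have nn : n.+2%:R^-1 <= n.+1%:R^-1 :> R by rewrite lef_pV2 ?posrE// ler_nat.
  move=> []; rewrite /= !in_itv/= ?andbT => h; [left|right];
    rewrite /= in_itv/= ?andbT; move: h nn;
    by move: (n.+1%:R^-1) (n.+2%:R^-1) => c c'; lra.
have := @ge0_nondecreasing_set_cvg_integral _ (measurableTypeR R) R A
  (fun t : R => (log_kernel t)%:E) mu ndA mA (fun n => mk (A n)) (fun n t _ => k0 t).
rewrite UA => cA.
have : (\int[mu]_(t in [set~ 0%R]) (log_kernel t)%:E <= 16%:E)%E.
  have -> := esym (cvg_lim _ cA) => //.
  apply: lime_le; first by apply/cvg_ex; eexists; exact: cA.
  by apply: nearW => n; exact: IA.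
rewrite -setTD integral_setD1; [|exact: measurableD|exact: mk].
by move=> /le_lt_trans; apply; rewrite ltry.
Qed.

Lemma integrable_log_kernel : mu.-integrable setT (EFin \o log_kernel).
Proof.
apply/integrableP; split; first by apply/measurable_EFinP; exact: measurable_log_kernel.
under eq_integral do rewrite /= ger0_norm ?log_kernel_ge0//.
exact: integral_log_kernel_lty.
Qed.

(** On the interval from 1 to 2 the kernel stays above the positive constant [log_kernel 2]. *)
Lemma integral_log_kernel_gt0 : 0 < \int[mu]_t log_kernel t.
Proof.
have k0 t : (0 <= (log_kernel t)%:E)%E by rewrite lee_fin log_kernel_ge0.
have mk (D : set R) : measurable_fun D (fun t : R => (log_kernel t)%:E).
  by apply/measurable_EFinP/measurable_funTS; exact: measurable_log_kernel.
have k2 t : 1 <= t <= 2 -> log_kernel 2 <= log_kernel t.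
  move=> /andP[t1 t2]; have t0 : 0 < t by lra.
  have e1 : 1 < expR t by rewrite -expR0 ltr_expR.
  have e2 : expR t <= expR 2 by rewrite ler_expR.
  rewrite /log_kernel !(distrC 1) !gtr0_norm; [|lra..].
  rewrite lerBlDr addrAC lerBrDr -!lnM ?posrE; [|lra..].
  by rewrite ler_ln ?posrE ?mulr_gt0//; nra.
apply: fine_gt0; apply/andP; split; last exact: integral_log_kernel_lty.
apply: (@lt_le_trans _ _ (\int[mu]_(t in `[1%R, 2%R]) (log_kernel 2)%:E)%E).
  rewrite integral_cst//= lebesgue_measure_itv/= lte_fin ifT; last by lra.
  by rewrite -EFinB -EFinM lte_fin mulr_gt0 ?log_kernel_gt0//; lra.
apply: (@le_trans _ _ (\int[mu]_(t in `[1%R, 2%R]) (log_kernel t)%:E)%E).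
  apply: ge0_le_integral => //.
  exact: mk.
by apply: ge0_subset_integral => //; exact: mk.
Qed.

(** With [e = expR (t + ln |v / u|)], factoring out [u] leaves [1 + e] and [1 - e], in an order
    decided by the sign of [u * v]. The excluded [t] is the one where [e = 1] and a logarithm is
    singular. *)
Lemma log_kernel_shift u v t : u * v != 0 -> t + ln `|v / u| != 0 ->
  [/\ u + expR t * v != 0, u - expR t * v != 0 &
   ln `|u + expR t * v| - ln `|u - expR t * v| =
   Num.sg (u * v) * log_kernel (t + ln `|v / u|)].
Proof.
move=> uv0 t0; have := uv0; rewrite mulf_eq0 negb_or => /andP[u0 v0].
have vu0 : 0 < `|v / u| by rewrite normr_gt0 mulf_neq0// invr_eq0.
have u'0 : 0 < `|u| by rewrite normr_gt0.
set e := expR (t + ln `|v / u|).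
have e0 : 0 < e := expR_gt0 _.
have e1 : 1 - e != 0 := onem_expR_neq0 t0.
have e1' : 0 < `|1 - e| by rewrite normr_gt0.
have E : expR t * v = u * (Num.sg (u * v) * e).
  rewrite /e expRD lnK ?posrE// normrM normfV sgrM !normrEsg invfM invr_sg.
  have su2 : Num.sg u * Num.sg u = 1 by rewrite -expr2 sqr_sg u0.
  have sv2 : Num.sg v * Num.sg v = 1 by rewrite -expr2 sqr_sg v0.
  transitivity ((u / u) * (Num.sg u * Num.sg u) * (Num.sg v * Num.sg v) * (expR t * v));
    last by ring.
  by rewrite divff// su2 sv2 !mul1r.
have Wp : u + expR t * v = u * (1 + Num.sg (u * v) * e) by rewrite E mulrDr mulr1.
have Wm : u - expR t * v = u * (1 - Num.sg (u * v) * e) by rewrite E mulrBr mulr1.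
rewrite /log_kernel -/e Wp Wm !normrM.
have [uv|uv|uv] := sgrP (u * v); first by rewrite uv eqxx in uv0.
  rewrite !mul1r (gtr0_norm (_ : 0 < 1 + e)); last by lra.
  by split; [rewrite mulf_neq0//; lra|rewrite mulf_neq0|rewrite !lnM ?posrE; lra].
rewrite !mulN1r opprK (gtr0_norm (_ : 0 < 1 + e)); last by lra.
by split; [rewrite mulf_neq0|rewrite mulf_neq0//; lra|rewrite !lnM ?posrE; lra].
Qed.

End log_kernel.

(** * The tail of the ratio *)

(** Both sides vanish at [q = 1] with equal slope there, and the derivative of their difference is a
    nonnegative multiple of [(x - 1) ^+ 2]. *)
Lemma ln_ratio_le {R : realType} (h q : R) : 0 < h <= 1 -> 1 <= q ->
  ln (q + h) - ln (1 + h * q) <= (1 - h) / (1 + h) * ln q.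
Proof.
move=> /andP[h0 h1] q1.
pose c : R := (1 - h) / (1 + h).
pose G (x : R) : R := c * ln x - (ln (x + h) - ln (1 + h * x)).
have dG (x : R) : 0 < x ->
    is_derive x 1 G (c * x^-1 - ((x + h)^-1 * 1 - (1 + h * x)^-1 * h)).
  move=> x0.
  have xh : 0 < x + h by lra.
  have hx : 0 < 1 + h * x by nra.
  have d1 : is_derive x 1 (fun x : R => x + h) 1.
    have dc : is_derive x 1 (cst h) 0 by exact: is_derive_cst.
    by apply: (is_derive_eq (is_deriveD (is_derive_id x 1) dc)); rewrite addr0.
  have d2 : is_derive x 1 (fun x : R => 1 + h * x) h.
    have dc : is_derive x 1 (cst (1 : R)) 0 by exact: is_derive_cst.
    apply: (is_derive_eq (is_deriveD dc (is_deriveZ h (is_derive_id x 1)))).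
    by rewrite add0r /GRing.scale/= mulr1.
  have l1 := @is_derive1_comp R (@ln R) (fun x : R => x + h) x _ _ (is_derive1_ln xh) d1.
  have l2 := @is_derive1_comp R (@ln R) (fun x : R => 1 + h * x) x _ _ (is_derive1_ln hx) d2.
  exact: (is_derive_eq (is_deriveB (is_deriveZ c (is_derive1_ln x0)) (is_deriveB l1 l2))).
have G1 : G 1 = 0 by rewrite /G ln1 mulr0 mulr1 (addrC 1) subrr subr0.
suff : G 1 <= G q by rewrite G1 /G subr_ge0.
apply: (@ger0_derive1_ndecry R G 1 _ _ _ 1 q (lexx 1) q1).
- by move=> x; rewrite in_itv/= andbT => x1; have [] := dG x (lt_trans ltr01 x1).
- move=> x; rewrite in_itv/= andbT => x1; have x0 := lt_trans ltr01 x1.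
  have [_] := dG x x0; rewrite derive1E => ->.
  rewrite (_ : _ - _ = h * (1 - h) * (x - 1) ^+ 2 /
    ((1 + h) * x * (x + h) * (1 + h * x))).
    have hx : 0 < 1 + h * x by nra.
    by rewrite divr_ge0 ?mulr_ge0 ?sqr_ge0//; lra.
  rewrite /c; field; rewrite !gt_eqF//; nra.
- apply: continuous_in_subspaceT => x; rewrite inE/= in_itv/= andbT => x1.
  apply: differentiable_continuous; apply/derivable1_diffP.
  by have [] := dG x (lt_le_trans ltr01 x1).
Qed.

(** Meant for [p = 1 + expR t] and [m = |1 - expR t|], where [A1] and [A2] are the scales, to the
    power [alpha], of [U + expR t * V] and [U - expR t * V]. With [q = (p / m) ^ alpha] one has
    [A1 / A2 = (q + h) / (1 + h q)], and [ln q] supplies the factor [alpha] that cancels. *)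
Lemma stable_scale_ratio_le {R : realType} (alpha Theta h p m : R) :
  0 < alpha -> 0 < Theta -> 0 < h <= 1 -> 0 < m -> m <= p ->
  let A1 := Theta * p `^ alpha + Theta * h * m `^ alpha in
  let A2 := Theta * m `^ alpha + Theta * h * p `^ alpha in
  [/\ 0 < A2, A2 <= A1 &
   (ln A1 - ln A2) / alpha <= (1 - h) / (1 + h) * (ln p - ln m)].
Proof.
move=> al0 Th0 h01 m0 mp A1 A2; have /andP[h0 h1] := h01.
have p0 := lt_le_trans m0 mp.
have pa : 0 < p `^ alpha by rewrite powR_gt0.
have ma : 0 < m `^ alpha by rewrite powR_gt0.
have mpa : m `^ alpha <= p `^ alpha by apply: ge0_ler_powR => //; rewrite ?nnegrE; lra.
pose q := p `^ alpha / m `^ alpha.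
have q1 : 1 <= q by rewrite ler_pdivlMr// mul1r.
have hq : 0 < 1 + h * q by nra.
have E1 : A1 = Theta * m `^ alpha * (q + h).
  by rewrite /A1 /q; field; rewrite gt_eqF.
have E2 : A2 = Theta * m `^ alpha * (1 + h * q).
  by rewrite /A2 /q; field; rewrite gt_eqF.
have Tm : 0 < Theta * m `^ alpha by rewrite mulr_gt0.
split.
- by rewrite E2 mulr_gt0.
- rewrite E1 E2 ler_pM2l//; nra.
rewrite E1 E2 !(@lnM _ (Theta * _)) ?posrE//; last by lra.
rewrite (_ : _ + _ - _ = ln (q + h) - ln (1 + h * q)); last by lra.
have := ln_ratio_le h01 q1; rewrite {3}/q lnM ?posrE ?invr_gt0// lnV// !ln_powR.
rewrite ler_pdivrMr// => /le_trans; apply.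
by rewrite le_eqVlt; apply/orP; left; apply/eqP; ring.
Qed.

Lemma expectation_cos_average d (T : measurableType d) (R : realType)
    (P : probability T R) (n : nat) (W : T -> R) (phi : R -> R) :
  measurable_fun setT W ->
  (forall x, \int[P]_w (cos (expR x * W w))%:E = (phi x)%:E)%E ->
  (\int[P]_w (cos_average n (W w))%:E =
   (\int[lebesgue_measure]_(x in `[- n%:R, n%:R]) phi x)%:E)%E.
Proof.
move=> mW Wphi.
pose mu := @lebesgue_measure R.
pose D : set (measurableTypeR R) := `[- n%:R, n%:R]%classic.
(* The window enters as an indicator so that Fubini applies on the whole line; [|cos| <= 1] and the
   window length [2 n] give integrability. *)
pose F (z : T * measurableTypeR R) : \bar R :=
  (cos (expR z.2 * W z.1) * \1_D z.2)%:E.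
have mD : measurable D by exact: measurable_itv.
have mF : measurable_fun setT F.
  apply/measurable_EFinP; apply: measurable_funM.
    apply: (measurableT_comp (@measurable_cos R)); apply: measurable_funM.
      by apply: (measurableT_comp (@measurable_expR R)); exact: measurable_snd.
    by apply: (measurableT_comp mW); exact: measurable_fst.
  have mI : measurable_fun setT (\1_D : measurableTypeR R -> R).
    exact: measurable_indic.
  exact: (measurableT_comp mI measurable_snd).
have innerE w : (\int[mu]_x F (w, x) = (cos_average n (W w))%:E)%E.
  rewrite /cos_average /Rintegral fineK.
    rewrite [RHS]integral_mkcond; apply: eq_integral => x _.
    rewrite /F patchE indicE/=; case: ifPn => _; by rewrite ?mulr1 ?mulr0.
  apply: integrable_fin_num => //; apply: continuous_itv_integrable => x.
  apply: continuous_comp; last exact: continuous_cos.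
  by apply: cvgM; [exact: continuous_expR|exact: cvg_cst].
have iF : (P \x mu)%E.-integrable setT F.
  apply/(integrable12ltyP _ _ mF).
  apply: (@le_lt_trans _ _ (\int[P]_w (2 * n%:R)%:E)%E); last first.
    by rewrite integral_cst//= probability_setT mule1 ltry.
  apply: ge0_le_integral => //.
  - by move=> w _; apply: integral_ge0.
  - apply: (measurable_fun_fubini_tonelli_F (abse \o F)) => //=.
    exact: measurableT_comp.
  - move=> w _.
    apply: (@le_trans _ _ (\int[mu]_x (\1_D x)%:E)%E).
      apply: ge0_le_integral => //.
      + apply/measurable_EFinP; apply: measurableT_comp => //.
        by apply/measurable_EFinP; exact: (measurableT_comp mF (measurable_pair1 w)).
      + by apply/measurable_EFinP; exact: measurable_indic.
      + move=> x _; rewrite /F lee_fin normrM [X in _ * X]ger0_norm ?indicE//=.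
        by rewrite ler_piMl// cos_max.
    rewrite integral_indic//= setIT /D lebesgue_measure_itv/= lte_fin.
    case: ifPn => _; rewrite -?EFinB lee_fin; last by rewrite mulr_ge0.
    by lra.
under eq_integral do rewrite -innerE.
have F12 := Fubini iF; rewrite F12.
have i21 : (\int[mu]_x \int[P]_w F (w, x) = \int[mu]_(x in D) (phi x)%:E)%E.
  rewrite [RHS]integral_mkcond; apply: eq_integral => x _.
  rewrite patchE; case: ifPn => xD.
    rewrite -Wphi; apply: eq_integral => w _; by rewrite /F indicE xD mulr1.
  by apply: integral0_eq => w _; rewrite /F indicE (negbTE xD) mulr0.
rewrite i21 /Rintegral fineK// -i21 -F12 integral12_prod_meas1//.
exact: integrable_fin_num.
Qed.

(** * Expected sign of [U * V] and the resulting tail bound *)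

Section ratio_tail.
Context {d : measure_display} {T : measurableType d} {R : realType}.
Context (P : probability T R) (X Y : {RV P >-> R}) (alpha Theta eps : R).
Hypotheses (alpha_gt0 : 0 < alpha) (Theta_gt0 : 0 < Theta) (eps_gt0 : 0 < eps).
Let h : R := eps `^ alpha / Theta.
Hypothesis h_le1 : h <= 1.
Hypothesis cfXY : forall a b : R,
  (\int[P]_w (cos (a * X w + b * Y w))%:E =
   (expR (- (Theta * `|a| `^ alpha + `|b| `^ alpha)))%:E)%E.

Let mu := @lebesgue_measure R.
Let U w : R := X w - eps * Y w.
Let V w : R := X w + eps * Y w.
Let C : R := \int[mu]_t log_kernel t.
(** A truncation of [ln |U + expR t * V| - ln |U - expR t * V|], bounded for each [n] and with an
    expectation computable from characteristic functions. *)
Let H (n : nat) (w : T) (t : R) : R :=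
  cos_average n (U w - expR t * V w) - cos_average n (U w + expR t * V w).

Let h_gt0 : 0 < h. Proof. by rewrite divr_gt0// powR_gt0. Qed.

Let C_gt0 : 0 < C. Proof. exact: integral_log_kernel_gt0. Qed.

Let CE : (\int[mu]_t (log_kernel t)%:E = C%:E)%E.
Proof.
by rewrite fineK//; apply: integrable_fin_num => //; exact: integrable_log_kernel.
Qed.

Let mU : measurable_fun setT U.
Proof. by apply: measurable_funB => //; exact: measurable_funM. Qed.

Let mV : measurable_fun setT V.
Proof. by apply: measurable_funD => //; exact: measurable_funM. Qed.

Let mH n : measurable_fun setT (fun z : measurableTypeR R * T => H n z.2 z.1).
Proof.
have mc : measurable_fun setT (cos_average n : R -> R).
  by apply: continuous_measurable_fun; exact: cos_average_continuous.
have mU1 : measurable_fun setT (fun z : measurableTypeR R * T => U z.2).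
  exact: (measurableT_comp mU measurable_snd).
have mV1 : measurable_fun setT (fun z : measurableTypeR R * T => expR (z.1 : R) * V z.2).
  apply: measurable_funM; last exact: (measurableT_comp mV measurable_snd).
  exact: (measurableT_comp (@measurable_expR R) measurable_fst).
apply: measurable_funB; apply: (measurableT_comp mc).
  exact: measurable_funB.
exact: measurable_funD.
Qed.

Let mHt n w : measurable_fun setT (fun t : measurableTypeR R => (H n w t)%:E).
Proof.
by apply/measurable_EFinP; exact: (measurableT_comp (mH n) (measurable_pair2 w)).
Qed.

Let mk c : measurable_fun setT (fun t : measurableTypeR R => (log_kernel (t + c))%:E).
Proof.
apply/measurable_EFinP; apply: (measurableT_comp measurable_log_kernel).
exact: (@measurable_funD _ R R setT id (cst c)).
Qed.

Let integral_kernel_shift c : (\int[mu]_t (log_kernel (t + c))%:E = C%:E)%E.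
Proof.
rewrite -CE (ge0_integral_shift c (f := fun t => (log_kernel t)%:E))//.
  by apply/measurable_EFinP; exact: measurable_log_kernel.
by move=> t; rewrite lee_fin log_kernel_ge0.
Qed.

Let integrable_kernel_shift c (a : R) :
  mu.-integrable setT (fun t => (a * log_kernel (t + c))%:E).
Proof.
under [X in _.-integrable _ X]eq_fun do rewrite EFinM.
apply: integrableZl => //; apply/integrableP; split; first exact: mk.
under eq_integral do rewrite /= ger0_norm ?log_kernel_ge0//.
by rewrite integral_kernel_shift ltry.
Qed.

(** This covers the outcomes where [ln |V / U|] has no meaning; the value agrees with
    [Num.sg 0 = 0]. *)
Let H_eq0 n w t : U w * V w = 0 -> H n w t = 0.
Proof.
rewrite /H => /eqP; rewrite mulf_eq0 => /orP[] /eqP ->.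
  by rewrite sub0r add0r cos_averageN subrr.
by rewrite mulr0 subr0 addr0 subrr.
Qed.

Let c w : R := ln `|V w / U w|.

Let norm_H_le n w t : U w * V w != 0 -> t + c w != 0 ->
  `|H n w t| <= 2 * log_kernel (t + c w).
Proof.
move=> uv0 tc; have [w10 w20 E] := log_kernel_shift uv0 tc.
apply: le_trans (norm_cos_averageB_le n w10 w20) _.
rewrite E normrM (ger0_norm (log_kernel_ge0 _)) ler_pM2l// ler_piMl ?log_kernel_ge0//.
by rewrite normr_sg uv0.
Qed.

Let ae_neq (a : R) (Q : R -> Prop) :
  (forall t, t + a != 0 -> Q t) -> {ae mu, forall t, Q t}.
Proof.
move=> Qt; exists [set - a]; split => //; first exact: lebesgue_measure_set1.
move=> t /= nQ; apply/eqP; rewrite -subr_eq0 opprK; apply/negPn/negP => ta.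
exact: nQ (Qt _ ta).
Qed.

(** Uniformity in [n] and [w] matters: the bound gives joint integrability for Fubini and dominates
    the limit under [P]. *)
Let integral_norm_H_le n w : (\int[mu]_t `|(H n w t)%:E| <= (2 * C)%:E)%E.
Proof.
have [uv0|uv0] := eqVneq (U w * V w) 0.
  under eq_integral do rewrite H_eq0// abse0.
  by rewrite integral0 lee_fin mulr_ge0// ltW.
apply: (@le_trans _ _ (\int[mu]_t (2 * log_kernel (t + c w))%:E)%E).
  apply: ae_ge0_le_integral => //.
  - exact: measurableT_comp.
  - by move=> t _; rewrite lee_fin mulr_ge0// log_kernel_ge0.
  - by have /integrableP[] := integrable_kernel_shift (c w) 2.
  - by apply: (@ae_neq (c w)) => t tc _; rewrite lee_fin norm_H_le.
under eq_integral do rewrite EFinM.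
rewrite ge0_integralZl//; last by move=> t _; rewrite lee_fin log_kernel_ge0.
by rewrite integral_kernel_shift -EFinM.
Qed.

(** Dominated convergence in [t]. The limit is the signed kernel translated by [c w], and
    translation invariance makes its integral independent of [w] up to the sign. *)
Let cvg_integral_H w :
  (\int[mu]_t (H n w t)%:E)%E @[n --> \oo] --> (Num.sg (U w * V w) * C)%:E.
Proof.
have [uv0|uv0] := eqVneq (U w * V w) 0.
  rewrite uv0 sgr0 mul0r; under eq_fun.
    by move=> n; under eq_integral do rewrite H_eq0//; rewrite integral0; over.
  exact: cvg_cst.
have -> : ((Num.sg (U w * V w) * C)%:E =
    \int[mu]_t (Num.sg (U w * V w) * log_kernel (t + c w))%:E)%E.
  under eq_integral do rewrite EFinM.
  rewrite integralZl//; first by rewrite integral_kernel_shift -EFinM.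
  have := integrable_kernel_shift (c w) 1.
  by under [X in _.-integrable _ X -> _]eq_fun do rewrite mul1r.
have [] := @dominated_convergence _ (measurableTypeR R) R mu setT measurableT
  (fun n t => (H n w t)%:E)
  (fun t => (Num.sg (U w * V w) * log_kernel (t + c w))%:E)
  (fun t => (2 * log_kernel (t + c w))%:E).
- by move=> n; exact: mHt.
- by have /integrableP[] := integrable_kernel_shift (c w) (Num.sg (U w * V w)).
- apply: (@ae_neq (c w)) => t tc _.
  have [w10 w20 E] := log_kernel_shift uv0 tc.
  by apply: cvg_EFin; [exact: nearW|rewrite -E; exact: cvg_cos_averageB].
- exact: integrable_kernel_shift.
- by apply: (@ae_neq (c w)) => t tc n _; rewrite lee_fin norm_H_le.
by move=> _ _.
Qed.

Let powR_expR x : (expR x) `^ alpha = expR (alpha * x).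
Proof. by rewrite /powR gt_eqF ?expR_gt0// expRK. Qed.

Let expectation_cos_average_XY n a b :
  (\int[P]_w (cos_average n (a * X w + b * Y w))%:E =
   (\int[mu]_(x in `[- n%:R, n%:R])
     expR (- ((Theta * `|a| `^ alpha + `|b| `^ alpha) * expR (alpha * x))))%:E)%E.
Proof.
apply: expectation_cos_average; first by apply: measurable_funD; exact: measurable_funM.
move=> x; under eq_integral do rewrite mulrDr !mulrA.
rewrite cfXY; congr (expR (- _))%:E.
rewrite !normrM !(ger0_norm (expR_ge0 _)) !powRM ?expR_ge0//.
by rewrite powR_expR; ring.
Qed.

Let integrable_cos_average n (W : T -> R) : measurable_fun setT W ->
  P.-integrable setT (EFin \o (fun w => cos_average n (W w))).
Proof.
move=> mW; apply: (@probability_integrable_bounded _ _ _ _ _ (2 * n%:R)).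
  apply: measurableT_comp mW.
  by apply: continuous_measurable_fun; exact: cos_average_continuous.
by move=> w; exact: norm_cos_average_le.
Qed.

(** For fixed [t] both arguments are linear combinations of [X] and [Y], so only their scales count.
    At [t = 0] the quantity [|1 - expR t|], which must be positive, would vanish. *)
Let expectation_H_le n t : t != 0 ->
  (\int[P]_w (H n w t)%:E <= ((1 - h) / (1 + h) * log_kernel t)%:E)%E.
Proof.
move=> t0; set e := expR t.
have e0 : 0 < e := expR_gt0 t.
have e1 : 0 < `|1 - e| by rewrite normr_gt0; exact: onem_expR_neq0.
have W1E w : U w + e * V w = (1 + e) * X w + (- (eps * (1 - e))) * Y w.
  by rewrite /U /V; ring.
have W2E w : U w - e * V w = (1 - e) * X w + (- (eps * (1 + e))) * Y w.
  by rewrite /U /V; ring.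
have mW a b : measurable_fun setT (fun w => a * X w + b * Y w).
  by apply: measurable_funD; exact: measurable_funM.
under eq_integral do rewrite /H W1E W2E EFinB.
rewrite integralB_EFin//; [|exact: integrable_cos_average..].
rewrite !expectation_cos_average_XY -EFinB lee_fin !normrN !normrM.
rewrite (gtr0_norm eps_gt0) (gtr0_norm (_ : 0 < 1 + e)); last by rewrite addr_gt0.
rewrite !powRM ?(ltW eps_gt0) ?(ltW e1)//; last by rewrite addr_ge0// ltW.
have -> : eps `^ alpha = Theta * h.
  by rewrite /h mulrC divfK// gt_eqF.
have e1e : `|1 - e| <= 1 + e by rewrite ler_norml; lra.
have h01 : 0 < h <= 1 by rewrite h_gt0.
have [A20 A21 le] := stable_scale_ratio_le alpha_gt0 Theta_gt0 h01 e1 e1e.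
exact: le_trans (exp_average_le n alpha_gt0 A20 A21) le.
Qed.

Let integrable_H n :
  (mu \x P)%E.-integrable setT (fun z : measurableTypeR R * T => (H n z.2 z.1)%:E).
Proof.
pose F (z : measurableTypeR R * T) := (H n z.2 z.1)%:E.
have mF : measurable_fun setT F by apply/measurable_EFinP; exact: mH.
apply/(integrable21ltyP _ _ mF).
apply: (@le_lt_trans _ _ (\int[P]_w (2 * C)%:E)%E); last first.
  by rewrite integral_cst//= probability_setT mule1 ltry.
apply: ge0_le_integral => //.
- by move=> w _; apply: integral_ge0.
- apply: (measurable_fun_fubini_tonelli_G (abse \o F)) => //=.
  exact: measurableT_comp.
- by move=> w _; exact: integral_norm_H_le.
Qed.

Let integral_H_le n :
  (\int[P]_w \int[mu]_t (H n w t)%:E <= ((1 - h) / (1 + h) * C)%:E)%E.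
Proof.
rewrite -(Fubini (integrable_H n)).
have iG := integrable_fubini_F (integrable_H n).
have -> : ((1 - h) / (1 + h) * C)%:E =
    (\int[mu]_t ((1 - h) / (1 + h) * log_kernel t)%:E)%E.
  under eq_integral do rewrite EFinM.
  by rewrite integralZl ?CE -?EFinM//; exact: integrable_log_kernel.
have ik : mu.-integrable setT (fun t => ((1 - h) / (1 + h) * log_kernel t)%:E).
  have := integrable_kernel_shift 0 ((1 - h) / (1 + h)).
  by under [X in _.-integrable _ X -> _]eq_fun do rewrite addr0.
have mD : measurable ([set: R] `\ 0%R) by exact: measurableD.
(* The pointwise bound fails to cover [t = 0], so this null point is removed from both integrals. *)
rewrite -[leLHS](@integral_setD1 R _ (0 : R) setT)//; last first.
  by apply: measurable_funTS; have /integrableP[] := iG.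
rewrite -[leRHS](@integral_setD1 R _ (0 : R) setT)//; last first.
  by apply: measurable_funTS; have /integrableP[] := ik.
apply: le_integral => //.
- exact: integrableS iG.
- exact: integrableS ik.
by move=> t; rewrite inE/= => -[_ /eqP t0]; exact: expectation_H_le.
Qed.

Let mS : measurable_fun setT (fun w => Num.sg (U w * V w)).
Proof.
have msg : measurable_fun setT (@Num.sg R).
  apply: nondecreasing_measurable => // x y xy.
  by case: (sgrP x) => ?; case: (sgrP y) => ?; lra.
by apply: measurableT_comp => //; exact: measurable_funM.
Qed.

Let norm_sg_le (x : R) : `|Num.sg x| <= 1.
Proof. by rewrite normr_sg; case: (x != 0). Qed.

Let iS : P.-integrable setT (EFin \o (fun w => Num.sg (U w * V w))).
Proof.
exact: (@probability_integrable_bounded _ _ _ _ _ 1).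
Qed.

(** The limit [n -> oo] is taken under [P] with the constant dominating function [2 * C]; then
    [C > 0] cancels. *)
Let expectation_sg_le :
  (\int[P]_w (Num.sg (U w * V w))%:E <= ((1 - h) / (1 + h))%:E)%E.
Proof.
have [] := @dominated_convergence _ T R P setT measurableT
  (fun n w => \int[mu]_t (H n w t)%:E)%E
  (fun w => (Num.sg (U w * V w) * C)%:E) (fun=> (2 * C)%:E).
- by move=> n; exact: (measurable_fubini_G (integrable_H n)).
- by apply/measurable_EFinP; exact: measurable_funM.
- by apply: aeW => w _; exact: cvg_integral_H.
- apply/integrableP; split => //.
  by rewrite integral_cst//= probability_setT mule1 ltry.
- apply: aeW => w n _; apply: le_trans (integral_norm_H_le n w).
  by apply: le_abse_integral => //; exact: mHt.
move=> _ _ cvgH.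
have : (\int[P]_w (Num.sg (U w * V w) * C)%:E <= ((1 - h) / (1 + h) * C)%:E)%E.
  rewrite -(cvg_lim _ cvgH)//; apply: lime_le.
    by apply/cvg_ex; eexists; exact: cvgH.
  by apply: nearW => n; exact: integral_H_le.
under eq_integral do rewrite EFinM.
rewrite integralZr// EFinM lee_pmul2r//.
Qed.

(** Since [U * V = X ^ 2 - (eps * Y) ^ 2], the event is [0 < U * V], and the sign bound concludes
    through [(1 + (1 - h) / (1 + h)) / 2 = 1 / (1 + h)]. *)
Lemma probability_ratio_gt_le :
  (P [set w | (eps * `|Y w| < `|X w|)%R] <= ((1 + h)^-1)%:E)%E.
Proof.
have -> : [set w | eps * `|Y w| < `|X w|] = [set w | 0 < U w * V w].
  apply/funext => w /=; congr is_true.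
  rewrite (_ : U w * V w = `|X w| ^+ 2 - (eps * `|Y w|) ^+ 2).
    by rewrite subr_gt0 ltr_pXn2r// nnegrE mulr_ge0// ltW.
  by rewrite exprMn !real_normK ?num_real// /U /V; ring.
have mE : measurable [set w | 0 < U w * V w].
  rewrite (_ : [set w | _] = (fun w => U w * V w) @^-1` `]0, +oo[%classic); last first.
    by apply/seteqP; split => w /=; rewrite in_itv/= andbT.
  by rewrite -[_ @^-1` _]setTI; exact: (measurable_funM mU mV).
rewrite -(setIT [set w | _]) -integral_indic//.
have iI : P.-integrable setT (fun w => (2^-1 * (1 + Num.sg (U w * V w)))%:E).
  apply: (@probability_integrable_bounded _ _ _ _ _ 1).
    by apply: measurable_funM => //; exact: measurable_funD.
  by move=> w; have := norm_sg_le (U w * V w); rewrite !ler_norml; lra.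
(* Only an inequality: where [U * V = 0] the indicator is 0 and the right side is 1/2. *)
apply: (@le_trans _ _ (\int[P]_w (2^-1 * (1 + Num.sg (U w * V w)))%:E)%E).
  apply: ge0_le_integral => //.
  - by apply/measurable_EFinP; exact: measurable_indic.
  - by have /integrableP[] := iI.
  move=> w _; rewrite lee_fin indicE.
  have [/set_mem/= uv|_] := boolP (w \in [set w | 0 < U w * V w]).
    by rewrite gtr0_sg// mulr1n; lra.
  rewrite mulr0n; have := norm_sg_le (U w * V w); rewrite ler_norml; lra.
under eq_integral do rewrite EFinM EFinD.
have i1 : P.-integrable setT (EFin \o (cst (1 : R))).
  exact: finite_measure_integrable_cst.
rewrite integralZl//; last exact: integrableD.
rewrite integralD_EFin// integral_cst//= probability_setT mule1.
rewrite -(fineK (integrable_fin_num _ iS))// -EFinD -EFinM lee_fin.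
have := expectation_sg_le; rewrite -(fineK (integrable_fin_num _ iS))// lee_fin.
move: (fine _) => m hm.
have -> : (1 + h)^-1 = 2^-1 * (1 + (1 - h) / (1 + h)) by field; rewrite gt_eqF// addr_gt0.
by rewrite ler_pM2l ?lerD2l// invr_gt0.
Qed.

End ratio_tail.

(** * The minimum estimator *)

(** The condition [s != 0] reflects the convention [y / 0 = 0]. *)
Lemma lt_norm_div {R : realType} (eps y s : R) : 0 < eps ->
  (eps < `|y / s|) = (s != 0) && (eps * `|s| < `|y|).
Proof.
move=> eps0; have [->|s0] /= := eqVneq s 0.
  by rewrite invr0 mulr0 normr0; apply/negbTE; rewrite -leNgt ltW.
by rewrite normf_div ltr_pdivlMr// normr_gt0.
Qed.

Lemma lt_norm_abs_min_est {R : realType} (M : nat) (y s : 'I_M -> R) (eps : R) :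
  0 < eps ->
  (eps < `|abs_min_est y s|) = (0 < M)%N && [forall j, eps < `|y j / s j|].
Proof.
move=> eps0; rewrite /abs_min_est /abs_min_index; case: pickP => [t /forallP tmin|nomin].
  rewrite (leq_ltn_trans (leq0n t) (ltn_ord t))/=.
  apply/idP/forallP => [lt j|]; last exact.
  exact: lt_le_trans lt (tmin j).
(* Without a minimizer the estimator is 0; this happens only for [M = 0], as a nonempty finite
   family attains its minimum. *)
rewrite normr0 [LHS]ltNge (ltW eps0)/=; apply/esym/negbTE.
case: M y s nomin => // M y s nomin; exfalso.
have := nomin [arg min_(j < ord0) `|y j / s j|]%O.
case: arg_minP => // j _ jmin /negbT/negP; apply.
by apply/forallP => k; exact: jmin.
Qed.

Theorem theorem1 (R : realType) (d : measure_display) (T : measurableType d)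
  (P : probability T R) (alpha : R) (N M : nat) (x : 'I_N -> R)
  (s : 'I_N -> 'I_M -> {RV P >-> R}) (eps : R) :
  0 < alpha < 1 ->
  (exists i, x i != 0) ->
  (forall i j, sym_stable P alpha (s i j)) ->
  mutually_independent P (fun p : 'I_N * 'I_M => (s p.1 p.2 : T -> R)) ->
  0 < eps ->
  let theta := (\sum_(i < N) `|x i| `^ alpha) `^ alpha^-1 in
  let psi := (eps / theta) `^ (alpha / (1 - alpha)) in
  psi <= 3^-1 ->
  forall i : 'I_N, x i = 0 ->
    (P [set w : T | (eps < `|abs_min_est (fun j => \sum_(k < N) x k * s k j w)
                                      (fun j => s i j w)|)%R]
     <= ((1 + psi) ^- M)%:E)%E.
Proof.
move=> /andP[al0 al1] [i0 xi0] st ind eps0 theta psi psi3 i xi.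
set Theta := \sum_(i < N) `|x i| `^ alpha in theta psi psi3 *.
have Theta0 : 0 < Theta.
  rewrite /Theta (bigD1 i0)//= ltr_wpDr ?powR_gt0 ?normr_gt0//.
  by apply: sumr_ge0 => k _; exact: powR_ge0.
have theta0 : 0 < theta by rewrite powR_gt0.
have thetaE : theta `^ alpha = Theta.
  by rewrite /theta -powRrM mulVf ?gt_eqF// powRr1// ltW.
have r0 : 0 < eps / theta by rewrite divr_gt0.
have be0 : 0 < alpha / (1 - alpha) by rewrite divr_gt0// subr_gt0.
(* Otherwise [psi] would be at least 1, against [psi <= 1/3]. *)
have r1 : eps / theta <= 1.
  rewrite leNgt; apply/negP => r1.
  have : 1 <= psi.
    rewrite (_ : 1 = 1 `^ (alpha / (1 - alpha))); last by rewrite powR1.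
    by apply: ge0_ler_powR; rewrite ?nnegrE ?(ltW be0) ?(ltW r1)// ltW.
  by move=> /le_trans /(_ psi3); lra.
have hE : eps `^ alpha / Theta = (eps / theta) `^ alpha.
  apply: (mulIf (lt0r_neq0 Theta0)); rewrite divfK ?gt_eqF//.
  by rewrite -thetaE -powRM ?(ltW r0) ?(ltW theta0)// divfK// gt_eqF.
set h := eps `^ alpha / Theta.
have h1 : h <= 1.
  rewrite /h hE (_ : 1 = 1 `^ alpha); last by rewrite powR1.
  apply: ge0_ler_powR; rewrite ?nnegrE ?(ltW al0) ?(ltW r0)//.
(* Here [h = (eps / theta) ^ alpha] with base at most 1, and the exponent [alpha / (1 - alpha)] is
   at least [alpha]. *)
have psih : psi <= h.
  rewrite /h hE /psi; apply: ger_powR; first by rewrite r0.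
  by rewrite ler_pdivlMr ?subr_gt0//; nra.
have psi0 : 0 <= psi by exact: powR_ge0.
have mXj j : measurable_fun setT (fun w => \sum_(k < N) x k * s k j w).
  by apply: measurable_sum => k; exact: measurable_funM.
pose S (p : 'I_N * 'I_M) : T -> R := s p.1 p.2.
have mS p : measurable_fun setT (S p) by exact: measurable_funP.
pose E j : set T := [set w | eps < `|(\sum_(k < N) x k * s k j w) / s i j w|].
have sE j : <<s cylinders S [pred p | p.2 == j] >> (E j).
  pose Tj := g_sigma_algebraType (cylinders S [pred p | p.2 == j]).
  have ms k : measurable_fun setT (s k j : Tj -> R).
    by apply: (@measurable_fun_cylinders _ T R _ S [pred p | p.2 == j] (k, j)); rewrite inE.
  have mX : measurable_fun setT ((fun w => \sum_(k < N) x k * s k j w) : Tj -> R).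
    by apply: measurable_sum => k; exact: measurable_funM.
  (* Clearing the denominator expresses the event through measurable functions of column [j]
     alone. *)
  rewrite (_ : E j = (s i j : Tj -> R) @^-1` [set~ 0] `&`
      ((fun w => `|\sum_(k < N) x k * s k j w| - eps * `|s i j w|) : Tj -> R) @^-1`
        `]0, +oo[%classic).
    apply: (@measurableI _ Tj).
      by rewrite -[_ @^-1` _]setTI; apply: ms => //; exact: measurableC.
    rewrite -[_ @^-1` _]setTI; apply: measurable_funB => //.
      exact: measurableT_comp.
    by apply: measurable_funM => //; exact: measurableT_comp.
  apply/seteqP; split => w; rewrite /E /= lt_norm_div// in_itv/= andbT subr_gt0.
    by move=> /andP[/eqP].
  by move=> [/eqP -> ->].
have PE j : (P (E j) <= ((1 + h)^-1)%:E)%E.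
  pose X : {RV P >-> R} := HB.pack (fun w => \sum_(k < N) x k * s k j w)
    (isMeasurableFun.Build _ _ _ _ _ (mXj j)).
  apply: le_trans (probability_ratio_gt_le (X := X) (Y := s i j) al0 Theta0 eps0 h1 _).
    apply: le_measure; rewrite ?inE.
    - exact: (sigma_cylinders_measurable mS (sE j)).
    - have mY : measurable_fun setT (fun w => `|X w| - eps * `|s i j w|).
        apply: measurable_funB; first exact: measurableT_comp.
        by apply: measurable_funM => //; exact: measurableT_comp.
      rewrite (_ : [set w | _] =
          (fun w => `|X w| - eps * `|s i j w|) @^-1` `]0, +oo[%classic).
        by rewrite -[_ @^-1` _]setTI; exact: mY.
      by apply/seteqP; split => w /=; rewrite in_itv/= andbT subr_gt0.
    - by move=> w; rewrite /E /= lt_norm_div// => /andP[].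
  move=> a b.
  (* As [x i = 0], the sum [X] contains no [s i j], so [a * X + b * Y] is one linear combination of
     the distinct entries of column [j]. *)
  pose c (p : 'I_N * 'I_M) := if p.1 == i then b else a * x p.1.
  have ur : uniq [seq (k, j) | k <- enum 'I_N].
    by rewrite map_inj_uniq ?enum_uniq// => k l [].
  have := integral_cos_sum_stable (X := fun p : 'I_N * 'I_M => s p.1 p.2)
    (fun p => st p.1 p.2) ind c ur.
  under eq_integral do rewrite big_map big_enum/=.
  rewrite big_map big_enum/=.
  under eq_integral => w _.
    rewrite (_ : \sum_(k < N) c (k, j) * s k j w = a * X w + b * s i j w); last first.
      rewrite (bigD1 i)//= [in RHS](bigD1 i)//= xi mul0r add0r /c/= eqxx addrC.
      congr (_ + _); rewrite big_distrr/=; apply: eq_bigr => k ki.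
      by rewrite (negbTE ki) mulrA.
    over.
  move=> ->; congr (expR (- _))%:E.
  (* The term of index [i] drops out of [Theta] because 0 to a nonzero power is 0. *)
  rewrite /Theta (bigD1 i)//= [in RHS](bigD1 i)//= xi normr0 powR0 ?gt_eqF//.
  rewrite add0r /c/= eqxx addrC; congr (_ + _).
  rewrite big_distrl/=; apply: eq_bigr => k ki.
  by rewrite (negbTE ki) normrM powRM// mulrC.
have -> : [set w : T | eps < `|abs_min_est (fun j => \sum_(k < N) x k * s k j w)
    (fun j => s i j w)|] = if (0 < M)%N then [set w | forall j, E j w] else set0.
  apply/seteqP; split => w /=; rewrite lt_norm_abs_min_est//.
    by move=> /andP[-> /forallP].
  by case: ifP => // _ Ew; apply/forallP.
case: ifPn => [_|_]; last by rewrite measure0 lee_fin invr_ge0 exprn_ge0// addr_ge0.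
rewrite (probability_block_independent mS ind sE).
(* Nonnegativity is carried along because multiplying inequalities of extended reals requires it. *)
suff /andP[_] : (0 <= \prod_j P (E j) <= (\prod_(j < M) (1 + psi)^-1)%:E)%E.
  by rewrite prodr_const card_ord exprVn.
apply: (big_ind2 (fun (a : \bar R) (b : R) => (0 <= a <= b%:E)%E)).
- by rewrite lee01 lexx.
- move=> a1 b1 a2 b2 /andP[a10 ab1] /andP[a20 ab2].
  by rewrite mule_ge0//= EFinM lee_pmul.
- move=> j _; rewrite measure_ge0/=; apply: le_trans (PE j) _.
  by rewrite lee_fin lef_pV2 ?posrE ?lerD2l// ltr_pwDl// (le_trans psi0).
Qed.
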